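(* If a graph $G$ has no vertex-minor isomorphic to $P_5$, then $\chi(G)\le\omega(G)+1$.
   Context: $P_5$ is the path on $5$ vertices. For a vertex $v$ of a graph $G$, the local complementation $G*v$ is the graph on $V(G)$ in which distinct $x,y$ are adjacent iff exactly one of the following holds: both $x$ and $y$ are neighbors of $v$ in $G$; $x$ is adjacent to $y$ in $G$. A graph $H$ is a vertex-minor of $G$ if $H$ is an induced subgraph of a graph obtained from $G$ by a sequence of local complementations. *)

(* Defs.v *)
From mathcomp Require Import all_boot.

Set Implicit Arguments.
Unset Strict Implicit.
Unset Printing Implicit Defensive.

Record sgraph := SGraph {
  vertex :> finType;
  adj : rel vertex;
  adj_sym : symmetric adj;
  adj_irrefl : irreflexive adj }.

Definition path_rel n : rel 'I_n := fun i j => (i.+1 == j) || (j.+1 == i).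

Lemma path_rel_sym n : symmetric (@path_rel n).
Proof. by move=> i j; rewrite /path_rel orbC. Qed.

Lemma path_rel_irrefl n : irreflexive (@path_rel n).
Proof. by move=> i; rewrite /path_rel orbb -[LHS]eq_sym ltn_eqF. Qed.

(* n is the number of vertices, not of edges. *)
Definition path_graph n : sgraph :=
  SGraph (@path_rel_sym n) (@path_rel_irrefl n).

Definition isomorphic (G H : sgraph) : Prop :=
  exists2 f : G -> H, bijective f & forall x y, adj (f x) (f y) = adj x y.

Section Constructions.

Variable G : sgraph.

Definition induced_rel (S : {set G}) : rel {x | x \in S} :=
  fun x y => adj (val x) (val y).

Lemma induced_rel_sym S : symmetric (@induced_rel S).
Proof. by move=> x y; apply: adj_sym. Qed.

Lemma induced_rel_irrefl S : irreflexive (@induced_rel S).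
Proof. by move=> x; apply: adj_irrefl. Qed.

Definition induced (S : {set G}) : sgraph :=
  SGraph (@induced_rel_sym S) (@induced_rel_irrefl S).

Definition lcomp_rel (v : G) : rel G :=
  fun x y => (x != y) && ((adj v x && adj v y) (+) adj x y).

Lemma lcomp_rel_sym v : symmetric (lcomp_rel v).
Proof.
by move=> x y; rewrite /lcomp_rel eq_sym (adj_sym x y) (andbC (adj v x)).
Qed.

Lemma lcomp_rel_irrefl v : irreflexive (lcomp_rel v).
Proof. by move=> x; rewrite /lcomp_rel eqxx. Qed.

Definition lcomp (v : G) : sgraph :=
  SGraph (@lcomp_rel_sym v) (@lcomp_rel_irrefl v).

Definition clique (A : {set G}) : bool :=
  [forall x in A, forall y in A, (x != y) ==> adj x y].

Definition clique_number : nat := \max_(A : {set G} | clique A) #|A|.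

Definition proper_coloring k (f : {ffun G -> 'I_k}) : bool :=
  [forall x, forall y, adj x y ==> (f x != f y)].

Definition colorable (k : nat) : bool :=
  [exists f : {ffun G -> 'I_k}, proper_coloring f].

Lemma ex_colorable : exists k, colorable k.
Proof.
exists #|G|; apply/existsP; exists [ffun x => enum_rank x].
apply/forallP=> x; apply/forallP=> y; apply/implyP=> xy.
rewrite !ffunE (inj_eq enum_rank_inj).
by apply: contraTneq xy => ->; rewrite adj_irrefl.
Qed.

Definition chromatic_number : nat := ex_minn ex_colorable.

End Constructions.

Inductive lcomp_reachable (G : sgraph) : sgraph -> Prop :=
| lcomp_refl : lcomp_reachable G G
| lcomp_step (H : sgraph) (v : H) :
    lcomp_reachable G H -> lcomp_reachable G (lcomp v).

(* G has a vertex-minor isomorphic to H. *)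
Definition has_vertex_minor (G H : sgraph) : Prop :=
  exists2 G' : sgraph, lcomp_reachable G G' &
    exists S : {set G'}, isomorphic (induced S) H.

(* Main.v *)
(* It suffices to colour each component C. If C has no triangle, take an edge
   uv and colour N(u), N(v) and the remaining vertices with 0, 1, 2: an edge
   among the remaining vertices would yield an induced P_5 ending with uv or vu.
   Otherwise let K be a maximum clique of C. If C \ K is independent, one
   further colour is enough. If not, there are a triangle a, c, b in K and an
   edge xy outside K such that x is adjacent to a but not to b, and y either
   distinguishes a from b or has no neighbour in {a, c, b}. When C has at most
   six vertices it is coloured by hand; otherwise two more vertices can be added
   to a, c, b, x, y one by one, keeping the subgraph connected, and an exhaustive
   search shows that one of the graphs obtained in this way has a P_5
   vertex-minor, reached by at most three local complementations. *)

Require Import Defs.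
From mathcomp Require Import all_boot.

Set Implicit Arguments.
Unset Strict Implicit.
Unset Printing Implicit Defensive.

(** * Induced paths and the five-vertex path as a vertex-minor *)

(** An induced path listed from one end; for consecutive vertices of a graph, distinctness follows
    from adjacency. *)
Fixpoint ipath (T : eqType) (e : rel T) (s : seq T) : bool :=
  if s is v :: s' then
    (if s' is u :: s'' then
       e v u && all (fun w => (v != w) && ~~ e v w) s''
     else true) && ipath e s'
  else true.

(** The position in [s] is an isomorphism from the subgraph induced on [s] onto the path. *)
Lemma ipath_P5_vertex_minor (G H : sgraph) (s : seq H) :
    lcomp_reachable G H -> size s = 5 -> ipath (@adj H) s ->
  has_vertex_minor G (path_graph 5).
Proof.
case: s => [|v0 [|v1 [|v2 [|v3 [|v4 [|? ?]]]]]] // GH _ /=.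
have neq (x y : H) : adj x y -> (x != y) * (y != x) * adj y x.
  move=> xy; have xNy : x != y by apply: contraTneq xy => ->; rewrite adj_irrefl.
  by rewrite (eq_sym y) adj_sym.
rewrite !andbT => /and4P[/and3P[e01 /andP[n02 a02] /andP[/andP[n03 a03]]]].
move=> /andP[n04 a04] /and3P[e12 /andP[n13 a13] /andP[n14 a14]].
move=> /andP[e23 /andP[n24 a24]] e34.
set s := [:: v0; v1; v2; v3; v4].
have us : uniq s.
  rewrite /= !inE !negb_or n02 n03 n04 n13 n14 n24.
  by rewrite (neq _ _ e01) (neq _ _ e12) (neq _ _ e23) (neq _ _ e34).
have es (i j : 'I_5) : adj (nth v0 s i) (nth v0 s j) = path_rel i j.
  have sym x y : ~~ @adj H x y -> (adj x y = false) * (adj y x = false).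
    by move=> /negbTE xy; rewrite (adj_sym y).
  case: i j => [i lti] [j ltj]; rewrite /path_rel /=.
  by case: i lti => [|[|[|[|[|i]]]]] // _;
    case: j ltj => [|[|[|[|[|j]]]]] // _ /=;
    rewrite ?adj_irrefl ?(sym _ _ a02) ?(sym _ _ a03) ?(sym _ _ a04)
      ?(sym _ _ a13) ?(sym _ _ a14) ?(sym _ _ a24)
      ?e01 ?e12 ?e23 ?e34
      ?(neq _ _ e01) ?(neq _ _ e12) ?(neq _ _ e23) ?(neq _ _ e34).
exists H => //; exists [set x in s].
have mems (i : 'I_5) : nth v0 s i \in [set x in s].
  by rewrite inE mem_nth.
have lts (x : induced [set x in s]) : index (val x) s < 5.
  by rewrite -[5]/(size s) index_mem; move: (valP x); rewrite inE.
pose f (x : induced [set x in s]) : 'I_5 := Ordinal (lts x).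
have fK : cancel f (fun i : 'I_5 => exist _ (nth v0 s i) (mems i)).
  by move=> x; apply: val_inj; rewrite /= nth_index // -index_mem lts.
exists f; last first.
  move=> x y; have:= es (f x) (f y).
  by rewrite /= !nth_index // -index_mem lts.
exists (fun i : 'I_5 => exist _ (nth v0 s i) (mems i)) => // i.
apply: val_inj; exact: index_uniq.
Qed.

(** * Computable search for a vertex-minor *)

(* [vm_compute] is strict, so [||] and [&&] would not cut the search short. *)
Definition lazy_has (T : Type) (a : pred T) : seq T -> bool :=
  fix loop s := if s is x :: s' then if a x then true else loop s' else false.

Lemma lazy_hasE (T : Type) (a : pred T) s : lazy_has a s = has a s.
Proof. by elim: s => //= x s ->; case: (a x). Qed.

(** Depth-first search with backtracking: the induced path [p] grows at its front, [k] vertices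
    being still missing. *)
Fixpoint grow (e : rel nat) n k (p : seq nat) : bool :=
  if k is k'.+1 then
    lazy_has (fun v => if ipath e (v :: p) then grow e n k' (v :: p) else false)
      (iota 0 n)
  else true.

Definition lc (v : nat) (e : rel nat) : rel nat :=
  fun i j => (i != j) && ((e v i && e v j) (+) e i j).

Fixpoint search n d (e : rel nat) : bool :=
  if d is d'.+1 then lazy_has (fun v => search n d' (lc v e)) (iota 0 n)
  else grow e n 5 [::].

(** At most three local complementations are tried, shorter sequences first. *)
Definition found n (e : rel nat) : bool :=
  lazy_has (fun d => search n d e) (iota 0 4).

Lemma growP (e : rel nat) n k p :
    ipath e p -> all (fun i => i < n) p -> grow e n k p ->
  exists q, [/\ ipath e q, all (fun i => i < n) q & size q = k + size p].
Proof.
elim: k p => [|k IH] p ep ltp; first by exists p.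
cbn [grow]; rewrite lazy_hasE => /hasP[v]; rewrite mem_iota => /= ltv.
case: ifP => // evp /(IH (v :: p) evp)[]; first by rewrite /= ltv.
by move=> q [eq ltq szq]; exists q; split; rewrite // szq addSnnS.
Qed.

Definition represents (H : sgraph) (x0 : H) (s : seq H) (e : rel nat) : Prop :=
  forall i j, i < size s -> j < size s ->
  e i j = adj (nth x0 s i) (nth x0 s j).

Lemma map_ipath (H : sgraph) (x0 : H) (s : seq H) (e : rel nat) p :
    uniq s -> represents x0 s e -> all (fun i => i < size s) p ->
  ipath e p -> ipath (@adj H) [seq nth x0 s i | i <- p].
Proof.
move=> us es; elim: p => [|v [|u p] IH] // /andP[ltv ltp].
case/andP=> /andP[evu vp] eup; rewrite [map _ _]/= [ipath _ _]/=.
apply/andP; split; last exact: IH.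
case/andP: ltp => ltu ltp.
rewrite -es // evu /=; apply/allP => _ /mapP[w wp ->].
have ltw := allP ltp w wp; have /andP[vw nvw] := allP vp w wp.
by rewrite nth_uniq // vw -es.
Qed.

(** Local complementation at a vertex of [s] changes adjacency within [s] exactly as [lc] does. It
    keeps the vertex type, so the same list [s] serves throughout the induction on [d]. *)
Lemma search_vertex_minor (G H : sgraph) (x0 : H) (s : seq H) d (e : rel nat) :
    lcomp_reachable G H -> uniq s -> represents x0 s e ->
  search (size s) d e -> has_vertex_minor G (path_graph 5).
Proof.
elim: d H x0 s e => [|d IH] H x0 s e GH us es.
  case/(@growP e _ _ [::] isT isT) => q [eq ltq szq].
  apply: (ipath_P5_vertex_minor GH _ (map_ipath us es ltq eq)).
  by rewrite size_map szq.
cbn [search]; rewrite lazy_hasE => /hasP[v]; rewrite mem_iota => /= ltv.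
apply: (IH (lcomp (nth x0 s v)) x0 s) => //; first exact: lcomp_step.
move=> i j lti ltj; rewrite /lc !es //=.
by rewrite /lcomp_rel nth_uniq.
Qed.

Lemma found_vertex_minor (G : sgraph) (x0 : G) (s : seq G) (e : rel nat) :
    uniq s -> represents x0 s e -> found (size s) e ->
  has_vertex_minor G (path_graph 5).
Proof.
move=> us es; rewrite /found lazy_hasE => /hasP[d _].
exact: (search_vertex_minor (lcomp_refl G) us es).
Qed.

(** * Adjacency tables and the exhaustive check *)

(* Row [i] lists the adjacencies of vertex [i] to the vertices below [i], so
   the default value of [nth] makes the relation irreflexive. *)
Definition tri (m : seq (seq bool)) : rel nat := fun i j =>
  if i < j then nth false (nth [::] m j) i else nth false (nth [::] m i) j.

Fixpoint all_bits n (P : pred (seq bool)) : bool :=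
  if n is n'.+1 then
    if all_bits n' (fun b => P (true :: b)) then
      all_bits n' (fun b => P (false :: b))
    else false
  else P [::].

Lemma all_bitsP n (P : pred (seq bool)) b : all_bits n P -> size b = n -> P b.
Proof.
elim: n P b => [|n IH] P [|c b] //= + [szb].
by case: ifP => // Pt Pf; case: c; [exact: (IH _ b Pt)|exact: (IH _ b Pf)].
Qed.

(** The row [b] attaches a new vertex to the graph [m] on [n] vertices; the zero row is skipped
    because extensions are kept connected. [P] takes over the extensions in which the search fails,
    so that checks can be nested. *)
Definition extensions_found n (m : seq (seq bool)) (P : pred (seq (seq bool))) :=
  all_bits n (fun b => if b == nseq n false then true else
    let m' := rcons m b in
    if found n.+1 (tri m') then true else P m').

(* [y0], [y1], [y2] are the adjacencies of y to a, c, b in the order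
   a, c, b, x, y of the vertices. *)
Definition stuck (y0 y1 y2 : bool) := (y0 != y2) || ~~ [|| y0, y1 | y2].

(** The free bits are the adjacency of x to c, in [bx], and those of y to a, c, b, in [b]. The final
    [xpred0] demands that the search succeed by the seventh vertex. *)
Definition obstruction_check : bool :=
  all_bits 1 (fun bx => all_bits 3 (fun b =>
    let m := [:: [::]; [:: true]; [:: true; true];
              [:: true; nth false bx 0; false];
              rcons b true] in
    if stuck (nth false b 0) (nth false b 1) (nth false b 2) then
      if found 5 (tri m) then true else
      extensions_found 5 m (fun m' => extensions_found 6 m' xpred0)
    else true)).

Lemma obstruction_checkT : obstruction_check.
Proof. by vm_compute. Qed.

Definition table (T : eqType) (e : rel T) (x0 : T) (s : seq T) :=
  mkseq (fun i => [seq e (nth x0 s i) w | w <- take i s]) (size s).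

Lemma table_rcons (T : eqType) (e : rel T) (x0 : T) s v :
  table e x0 (rcons s v) = rcons (table e x0 s) [seq e v w | w <- s].
Proof.
rewrite /table size_rcons mkseqS nth_rcons ltnn eqxx.
have -> : take (size s) (rcons s v) = s by rewrite -cats1 take_size_cat.
congr rcons; apply/eq_in_map => i; rewrite mem_iota => /= lti.
by rewrite nth_rcons lti -cats1 takel_cat // ltnW.
Qed.

Lemma represents_table (G : sgraph) (x0 : G) (s : seq G) :
  represents x0 s (tri (table (@adj G) x0 s)).
Proof.
have row i j : j < i < size s ->
    nth false (nth [::] (table (@adj G) x0 s) i) j =
    adj (nth x0 s i) (nth x0 s j).
  case/andP=> ltji lti; rewrite nth_mkseq // (nth_map x0) ?nth_take //.
  by rewrite size_take lti.
move=> i j lti ltj; rewrite /tri; case: ltngtP => [ltij|ltji|->].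
- by rewrite row ?ltij // adj_sym.
- by rewrite row ?ltji.
by rewrite adj_irrefl nth_mkseq // nth_default // size_map size_take ltj.
Qed.

(** * Obstructions around a triangle *)

Section NoP5.

Variable G : sgraph.
Hypothesis noP5 : ~ has_vertex_minor G (path_graph 5).

Local Notation w := (clique_number G).

Lemma found_table (x0 : G) (s : seq G) :
  uniq s -> found (size s) (tri (table (@adj G) x0 s)) = false.
Proof.
move=> us; apply/negP => /(found_vertex_minor us (@represents_table G x0 s)).
exact: noP5.
Qed.

(** Absence of the vertex-minor excludes [found], and the neighbour of [v] in [s] excludes the zero
    row; only [P] remains. *)
Lemma extensions_foundP n P (x0 : G) (s : seq G) v :
    size s = n -> uniq s -> extensions_found n (table (@adj G) x0 s) P ->
  v \notin s -> has (adj v) s -> P (table (@adj G) x0 (rcons s v)).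
Proof.
move=> sz us /all_bitsP chk vs vadj.
have := chk [seq adj v u | u <- s]; rewrite size_map => /(_ sz).
cbv beta zeta; rewrite -table_rcons.
have -> : n.+1 = size (rcons s v) by rewrite size_rcons sz.
rewrite found_table ?rcons_uniq ?vs //.
case: eqP => // all0; move: vadj.
have /= := congr1 (has id) all0; rewrite has_map (@eq_has _ _ (adj v)) // => ->.
by rewrite has_nseq andbF.
Qed.

(** Connectedness in the form applied below: a nonempty part of [C] closed under neighbours in [C]
    is all of [C]. *)
Definition linked (C : {set G}) : Prop :=
  forall S : {set G}, S \subset C -> S != set0 ->
  (forall x y, x \in S -> y \in C -> adj x y -> y \in S) -> C \subset S.

Lemma linked_extend (C : {set G}) (s : seq G) :
    linked C -> {subset s <= C} -> s != [::] ->
  {subset C <= s} \/ exists2 v, v \in C & (v \notin s) && has (adj v) s.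
Proof.
move=> Clink sC sn0.
have [/exists_inP[v]|] := boolP [exists v in C, (v \notin s) && has (adj v) s].
  by right; exists v.
rewrite negb_exists_in => /forall_inP noext; left => v vC.
suff /subsetP/(_ v vC) : C \subset [set x in s] by rewrite inE.
apply: Clink => [||x y].
- by apply/subsetP => x; rewrite inE => /sC.
- by case: s sn0 {sC noext} => // x s _; apply/set0Pn; exists x; rewrite !inE eqxx.
rewrite !inE => xs yC xy; apply: contraT => ys.
have := noext y yC; rewrite ys => /hasPn/(_ x xs).
by rewrite adj_sym xy.
Qed.

Lemma adj_neq (x y : G) : adj x y -> x != y.
Proof. by apply: contraTneq => ->; rewrite adj_irrefl. Qed.

(** Adding attached vertices one by one must stop at six, since seven would contradict the
    exhaustive check. *)
Lemma obstruction_small (C : {set G}) a c b x y :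
    linked C -> {subset [:: a; c; b; x; y] <= C} ->
    uniq [:: a; c; b; x; y] -> adj c a -> adj b a -> adj b c ->
    adj x a -> ~~ adj x b -> adj y x -> stuck (adj y a) (adj y c) (adj y b) ->
  exists p, {subset C <= [:: a; c; b; x; y; p]}.
Proof.
move=> Clink sC us ca ba bc xa xb yx yst.
have xbF := negbTE xb.
set s := [:: a; c; b; x; y] in sC us *.
have := all_bitsP (b := [:: adj x c]) obstruction_checkT erefl.
move=> /(all_bitsP (b := [:: adj y a; adj y c; adj y b]))/(_ erefl).
cbv beta zeta; rewrite [stuck _ _ _]yst.
have <- : table (@adj G) a s = [:: [::]; [:: true]; [:: true; true];
    [:: true; adj x c; false]; [:: adj y a; adj y c; adj y b; true]].
  by rewrite /table /mkseq /= ca ba bc xa xbF yx.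
rewrite (found_table a us) => chk.
have [Cs|[p pC /andP[ps padj]]] := linked_extend Clink sC isT.
  (* The five vertices already cover [C], so [p] may repeat [y]. *)
  by exists y => z /Cs; rewrite !inE => /or4P[->|->|->|/orP[]->]; rewrite ?orbT.
have {}chk := extensions_foundP erefl us chk ps padj.
have us' : uniq (rcons s p) by rewrite rcons_uniq ps.
have [|//|Cs|[q qC /andP[qs qadj]]] := @linked_extend C (rcons s p) Clink.
- by move=> z; rewrite mem_rcons inE => /predU1P[->|/sC].
- by exists p.
(* With a seventh vertex, the check yields [xpred0], which is absurd. *)
by have := extensions_foundP erefl us' chk qs qadj.
Qed.

(** * Cliques and colourings of a component *)

(** The colours are 0 to [w], with [w] taken from the whole of [G], so that all components share one
    palette. *)
Definition colorable_on (C : {set G}) : Prop :=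
  exists2 f : G -> nat, forall x, f x <= w &
    {in C &, forall x y, adj x y -> f x != f y}.

Lemma clique_adj (A : {set G}) x y :
  clique A -> x \in A -> y \in A -> x != y -> adj x y.
Proof.
by move=> /forall_inP clA xA yA xy; apply: (implyP (forall_inP (clA x xA) y yA)).
Qed.

Lemma clique_of_pairwise (A : {set G}) :
  {in A &, forall x y, x != y -> adj x y} -> clique A.
Proof.
move=> adjA; apply/forall_inP => x xA; apply/forall_inP => y yA.
by apply/implyP; apply: adjA.
Qed.

Lemma clique_card_le (A : {set G}) : clique A -> #|A| <= w.
Proof. exact: (@leq_bigmax_cond _ (@clique G) (fun A : {set G} => #|A|)). Qed.

Lemma cliqueU1 (A : {set G}) x :
  clique A -> {in A, forall y, adj x y} -> clique (x |: A).
Proof.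
move=> clA xA; apply: clique_of_pairwise => y z.
rewrite !inE => /predU1P[->|yA] /predU1P[->|zA]; first by rewrite eqxx.
- by move=> _; apply: xA.
- by move=> _; rewrite adj_sym; apply: xA.
exact: (clique_adj clA).
Qed.

Lemma clique1 (x : G) : clique [set x].
Proof.
by apply: clique_of_pairwise => y z /set1P-> /set1P->; rewrite eqxx.
Qed.

Lemma clique2 (x y : G) : adj x y -> clique [set x; y].
Proof. by move=> xy; apply: cliqueU1 (clique1 y) _ => z /set1P->. Qed.

Lemma clique3 (x y z : G) : adj x y -> adj x z -> adj y z -> clique [set x; y; z].
Proof.
move=> xy xz yz; rewrite -setUA; apply: cliqueU1 (clique2 yz) _ => u.
by case/set2P => ->.
Qed.

Lemma card_clique3 (x y z : G) :
  adj x y -> adj x z -> adj y z -> #|[set x; y; z]| = 3.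
Proof.
by move=> xy xz yz; rewrite -setUA cardsU1 cards2 !inE negb_or !adj_neq.
Qed.

(* The vertices off [s] get the colour [w], the default value of [nth]. *)
Lemma colorable_on_cover (C : {set G}) (x0 : G) (s : seq G) (col : seq nat) :
    size col = size s -> all (fun k => k < w) col ->
    (forall i j, i < j < size s -> adj (nth x0 s i) (nth x0 s j) ->
       nth w col i != nth w col j) ->
    {in C &, forall x y, x \notin s -> y \notin s -> ~~ adj x y} ->
  colorable_on C.
Proof.
move=> szc /(all_nthP w) ltc sP CP; pose f x := nth w col (index x s).
have fw x : x \notin s -> f x = w.
  by move=> xs; rewrite /f nth_default // szc memNindex.
have flt x : x \in s -> f x < w by move=> xs; rewrite ltc // szc index_mem.
have wlog_lt x y : x \in s -> y \in s -> index x s < index y s ->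
    adj x y -> f x != f y.
  by move=> xs ys lti xy; apply: sP; rewrite ?lti ?index_mem ?nth_index.
exists f => [x|x y xC yC xy].
  by have [/flt/ltnW|/fw->] := boolP (x \in s).
have [xs|xs] := boolP (x \in s); have [ys|ys] := boolP (y \in s).
- have [lti|lti|eqi] := ltngtP (index x s) (index y s).
  + exact: wlog_lt.
  + by rewrite eq_sym wlog_lt // adj_sym.
  by move: (adj_neq xy); rewrite -(nth_index x0 xs) eqi nth_index ?eqxx.
- by rewrite (fw y) // neq_ltn flt.
- by rewrite (fw x) // neq_ltn flt // orbT.
by have := CP _ _ xC yC xs ys; rewrite xy.
Qed.

(** At most one vertex lies off the five, and it takes the colour [w]. The lists below colour a, c,
    b, x, y in this order with colours less than [w]. *)
Lemma obstruction_colorable (C : {set G}) a c b x y :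
    linked C -> {subset [:: a; c; b; x; y] <= C} ->
    uniq [:: a; c; b; x; y] -> adj c a -> adj b a -> adj b c ->
    adj x a -> ~~ adj x b -> adj y x -> stuck (adj y a) (adj y c) (adj y b) ->
  colorable_on C.
Proof.
move=> Clink sC us ca ba bc xa xb yx yst.
have [p Cp] := obstruction_small Clink sC us ca ba bc xa xb yx yst.
have rest : {in C &, forall u v, u \notin [:: a; c; b; x; y] ->
    v \notin [:: a; c; b; x; y] -> ~~ adj u v}.
  have offs z : z \in C -> z \notin [:: a; c; b; x; y] -> z = p.
    move=> /Cp; rewrite (mem_cat z [:: a; c; b; x; y] [:: p]) mem_seq1 => + zs.
    by rewrite (negbTE zs) => /eqP.
  by move=> u v uC vC /(offs _ uC)-> /(offs _ vC)->; rewrite adj_irrefl.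
have w3 : 2 < w.
  have cl : clique [set c; a; b] by apply: clique3; rewrite // adj_sym.
  apply: leq_trans (clique_card_le cl).
  by rewrite card_clique3 // adj_sym.
have small col : size col = 5 -> all (fun k => k < w) col ->
    (forall i j, i < j < 5 ->
       adj (nth a [:: a; c; b; x; y] i) (nth a [:: a; c; b; x; y] j) ->
       nth w col i != nth w col j) -> colorable_on C.
  by move=> szc ltc colP; apply: (@colorable_on_cover C a [:: a; c; b; x; y] col).
have w1 := ltnW w3; have w0 := ltnW w1.
(* If [y] is not adjacent to [a], it shares the colour of [a], and [x] that of [b]. *)
have [ya|ya] := boolP (adj y a); last first.
  apply: (small [:: 0; 1; 2; 2; 0]) => [//||]; first by rewrite /= w3 w1 w0.
  case=> [|[|[|[|[|i]]]]] [|[|[|[|[|j]]]]] //=; rewrite ?andbF // => _.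
  - by rewrite adj_sym (negbTE ya).
  - by rewrite adj_sym (negbTE xb).
have yb : ~~ adj y b.
  by move: yst; rewrite /stuck ya /= => /orP[]//; case: (adj y b).
have [yc|yc] := boolP (adj y c); last first.
  apply: (small [:: 0; 1; 2; 2; 1]) => [//||]; first by rewrite /= w3 w1 w0.
  case=> [|[|[|[|[|i]]]]] [|[|[|[|[|j]]]]] //=; rewrite ?andbF // => _.
  - by rewrite adj_sym (negbTE yc).
  - by rewrite adj_sym (negbTE xb).
have [xc|xc] := boolP (adj x c); last first.
  apply: (small [:: 0; 1; 2; 1; 2]) => [//||]; first by rewrite /= w3 w1 w0.
  case=> [|[|[|[|[|i]]]]] [|[|[|[|[|j]]]]] //=; rewrite ?andbF // => _.
  - by rewrite adj_sym (negbTE xc).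
  - by rewrite adj_sym (negbTE yb).
(* Now a, c, x, y form a clique, which makes a fourth colour below [w] available for [y]. *)
have w4 : 3 < w.
  have cl : clique (y |: [set x; c; a]).
    apply: cliqueU1 (clique3 xc xa ca) _ => z.
    by rewrite !inE => /orP[/orP[]|] /eqP->.
  apply: leq_trans (clique_card_le cl).
  by rewrite cardsU1 card_clique3 // !inE !negb_or !adj_neq.
apply: (small [:: 0; 1; 2; 2; 3]) => [//||]; first by rewrite /= w4 w3 w1 w0.
case=> [|[|[|[|[|i]]]]] [|[|[|[|[|j]]]]] //=; rewrite ?andbF // => _.
by rewrite adj_sym (negbTE xb).
Qed.

(** * Components with a maximum clique of at least three vertices *)

(* A vertex set split by both [x] and [y] has a pair split by both: otherwise
   [y] would be constant on the complete bipartite graph between the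
   neighbours and the non-neighbours of [x]. *)
Lemma common_split (K : {set G}) (x y : G) :
    (exists2 a, a \in K & adj x a) -> (exists2 b, b \in K & ~~ adj x b) ->
    (exists2 a, a \in K & adj y a) -> (exists2 b, b \in K & ~~ adj y b) ->
  exists a b, [/\ a \in K, b \in K, adj x a, ~~ adj x b & adj y a != adj y b].
Proof.
case=> a aK xa [b bK xb] [a' aK' ya'] [b' bK' yb'].
have [yab|] := eqVneq (adj y a) (adj y b); last by exists a, b.
case ya : (adj y a) yab => yb.
  have [xb'|xb'] := boolP (adj x b').
    by exists b', b; split; rewrite // -yb (negbTE yb').
  by exists a, b'; split; rewrite // ya (negbTE yb').
have [xa'|xa'] := boolP (adj x a').
  by exists a', b; split; rewrite // -yb ya'.
by exists a, a'; split; rewrite // ya ya'.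
Qed.

Section LargeClique.

Variables C K : {set G}.
Hypotheses (Clink : linked C) (KC : K \subset C) (clK : clique K).
Hypothesis Kmax : forall A : {set G}, A \subset C -> clique A -> #|A| <= #|K|.
Hypothesis K3 : 2 < #|K|.

(** Otherwise [x |: K] would be a larger clique in [C]. *)
Lemma max_clique_nonadj x :
  x \in C -> x \notin K -> exists2 b, b \in K & ~~ adj x b.
Proof.
move=> xC xK; apply/exists_inP; rewrite -negb_forall_in; apply/negP.
move=> /forall_inP xadj; have := Kmax _ (cliqueU1 clK xadj).
by rewrite cardsU1 xK ltnn subUset sub1set xC KC => /(_ isT).
Qed.

Lemma max_clique_third a b :
  exists c, [/\ c \in K, c != a & c != b].
Proof.
have : 0 < #|K :\ a :\ b|.
  have := K3; rewrite (cardsD1 a) (cardsD1 b (K :\ a)).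
  by do 2!case: (_ \in _); case: #|_|.
by case/card_gt0P => c; rewrite !inE => /and3P[cb ca cK]; exists c.
Qed.

Lemma max_clique_edge_colorable x y :
    x \in C -> y \in C -> x \notin K -> y \notin K -> adj x y ->
    (exists2 a, a \in K & adj x a) ->
  colorable_on C.
Proof.
move=> xC yC xK yK xy xatt.
(* The two alternatives for [y] are those of [stuck]: it splits a pair that [x] splits too, or it
   has no neighbour in [K]. *)
have [a [b [aK bK xa xb yab]]] : exists a b, [/\ a \in K, b \in K, adj x a,
    ~~ adj x b & adj y a != adj y b \/ {in K, forall c, ~~ adj y c}].
  have [/exists_inP yatt|] := boolP [exists a in K, adj y a].
    have [a [b [? ? ? ? ?]]] := common_split xatt (max_clique_nonadj xC xK)
      yatt (max_clique_nonadj yC yK).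
    by exists a, b; split=> //; left.
  rewrite negb_exists_in => /forall_inP ynon.
  have [a aK xa] := xatt; have [b bK xb] := max_clique_nonadj xC xK.
  by exists a, b; split=> //; right.
have [c [cK ca cb]] := max_clique_third a b.
have ab : a != b by apply: contraNneq xb => <-.
have memK z : z \in K -> (z != x) * (z != y).
  by move=> zK; split; [move: xK|move: yK]; apply: contraNneq => <-.
apply: (@obstruction_colorable C a c b x y) => //.
- by move=> z; rewrite !inE => /or4P[||/eqP->|/orP[]/eqP->] // => [/eqP->|/eqP->|];
    apply: (subsetP KC).
- rewrite /= !inE !negb_or ab cb (eq_sym a c) ca (adj_neq xy).
  by rewrite !(memK a aK) !(memK b bK) !(memK c cK).
- exact: (clique_adj clK).
- by apply: (clique_adj clK); rewrite // eq_sym.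
- by apply: (clique_adj clK); rewrite // eq_sym.
- by rewrite adj_sym.
rewrite /stuck; case: yab => [->//|ynon].
by rewrite !(negbTE (ynon _ _)) ?orbT.
Qed.

Lemma max_clique_colorable : colorable_on C.
Proof.
pose S := [set x in C :\: K | [exists y in C :\: K, adj x y]].
have [/exists_inP[x]|] := boolP [exists x in S, [exists a in K, adj x a]].
  rewrite !inE => /andP[/andP[xK xC] /exists_inP[y]].
  rewrite !inE => /andP[yK yC] xy /exists_inP; exact: max_clique_edge_colorable xy.
rewrite negb_exists_in => /forall_inP Snon.
have /card_gt0P[a aK] : 0 < #|K| by apply: leq_trans K3.
(* No vertex of [S] has a neighbour in [K], so [S] is closed under neighbours in [C]; as it misses
   [a], it is empty, and [C :\: K] is independent. *)
have S0 : S = set0.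
  apply/eqP; apply: contraT => Sn0.
  suff /subsetP/(_ a (subsetP KC a aK)) : C \subset S by rewrite !inE aK.
  apply: (@Clink S _ Sn0) => [|x y xS yC xy].
  - by apply/subsetP => x; rewrite !inE => /andP[/andP[]].
  - have xCK : x \in C :\: K by move: xS; rewrite inE => /andP[].
    have yK : y \notin K.
      apply: contra (Snon x xS) => yK; apply/exists_inP.
      by exists y.
    by rewrite !inE yK yC; apply/exists_inP; exists x; rewrite // adj_sym.
(* The vertices of [K] get distinct colours below [w], and the rest get [w]. *)
apply: (@colorable_on_cover C a (enum K) (iota 0 #|K|)).
- by rewrite size_iota -cardE.
- apply/allP => i; rewrite mem_iota add0n => /leq_trans; apply.
  exact: clique_card_le.
- move=> i j; rewrite -cardE => /andP[ij jK] _.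
  by rewrite !nth_iota ?(ltn_trans ij jK) // !add0n neq_ltn ij.
move=> x y xC yC; rewrite !mem_enum => xK yK; apply/negP => xy.
have /setP/(_ x) := S0; rewrite !inE xK xC /= => /exists_inP[].
by exists y; rewrite // !inE yK.
Qed.

End LargeClique.

(** * Triangle-free components *)

Lemma triangle_free_colorable (C : {set G}) :
    linked C ->
    {in C & &, forall x y z, adj x y -> adj y z -> adj x z -> False} ->
  colorable_on C.
Proof.
move=> Clink Ctf.
have [/exists_inP[u uC /exists_inP[v vC uv]]|] :=
  boolP [exists u in C, [exists v in C, adj u v]]; last first.
  rewrite negb_exists_in => /forall_inP noadj; exists (fun=> 0) => // x y xC yC xy.
  by have /exists_inP[] := noadj x xC; exists y.
have w2 : 1 < w.
  by apply: leq_trans (clique_card_le (clique2 uv)); rewrite cards2 adj_neq.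
pose R := [set x in C | ~~ adj u x & ~~ adj v x].
have Rindep : {in R &, forall x y, ~~ adj x y}.
  pose S := [set x in R | [exists y in R, adj x y]].
  suff S0 : S = set0.
    move=> x y xR yR; apply/negP => xy; have /setP/(_ x) := S0.
    by rewrite in_set0 in_set xR => /exists_inP[]; exists y.
  (* The path is y, x, z, s, t; triangle-freeness excludes the chords yz and zt. *)
  have tailP x y z s t : x \in C -> y \in C -> z \in C -> s \in C -> t \in C ->
      adj y x -> adj x z -> adj z s -> adj s t ->
      ~~ adj x s -> ~~ adj x t -> ~~ adj y s -> ~~ adj y t -> False.
    move=> xC yC zC sC tC yx xz zs st xs xt ys yt.
    have neq p q r : adj p r -> ~~ @adj G q r -> q != p.
      by move=> pr; apply: contraNneq => ->.
    have yz : ~~ adj y z by apply/negP; exact: (Ctf y x z yC xC zC yx xz).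
    have zt : ~~ adj z t by apply/negP; exact: (Ctf z s t zC sC tC zs st).
    apply: noP5; apply: (ipath_P5_vertex_minor (lcomp_refl G) (s := [:: y; x; z; s; t])) => //=.
    have zx : adj z x by rewrite adj_sym.
    have ts : adj t s by rewrite adj_sym.
    have tx : ~~ adj t x by rewrite adj_sym.
    rewrite yx xz zs st yz ys yt xs xt zt (neq z y s zs ys) (neq s y t st yt).
    rewrite (neq t y s ts ys) (neq s x t st xt) (neq t x s ts xs).
    by rewrite eq_sym (neq z t x zx tx).
  apply/eqP; apply: contraT => Sn0.
  (* [S] is closed: a neighbour [z] of [x] outside [R] would be adjacent to [u] or [v] and give the
     forbidden path. But [u], a neighbour of [v], is not in [S]. *)
  suff /subsetP/(_ u uC) : C \subset S.
    by rewrite !inE (adj_sym v) uv /= !andbF.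
  apply: (@Clink S _ Sn0) => [|x z xS zC xz].
  - by apply/subsetP => x; rewrite !inE => /andP[/andP[]].
  - move: (xS); rewrite inE => /andP[xR /exists_inP[y yR xy]].
    have [zR|zR] := boolP (z \in R).
      by rewrite inE zR; apply/exists_inP; exists x; rewrite // adj_sym.
    move: xR yR; rewrite !inE => /and3P[xC ux vx] /and3P[yC uy vy].
    move: zR; rewrite inE zC /= negb_and !negbK => /orP[uz|vz]; exfalso.
    + by apply: (tailP x y z u v); rewrite // adj_sym.
    by apply: (tailP x y z v u); rewrite // adj_sym.
exists (fun x => if adj u x then 0 else if adj v x then 1 else 2).
  by move=> x; case: ifP => // _; case: ifP => // _; exact: ltnW.
move=> x y xC yC xy.
case ux: (adj u x); case uy: (adj u y) => //.
- by case: (Ctf u x y).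
- by case: ifP.
- by case: ifP.
case vx: (adj v x); case vy: (adj v y) => //.
  by case: (Ctf v x y).
by have := Rindep x y; rewrite !inE xC yC ux uy vx vy xy => /(_ isT isT).
Qed.

(** * From components to the whole graph *)

Lemma linked_colorable (C : {set G}) : linked C -> colorable_on C.
Proof.
move=> Clink.
have cl0 : (set0 \subset C) && clique (set0 : {set G}).
  by rewrite sub0set; apply: clique_of_pairwise => x; rewrite inE.
pose K := [arg max_(A > set0 | (A \subset C) && clique A) #|A|].
have [KC clK Kmax] : [/\ K \subset C, clique K &
    forall A : {set G}, A \subset C -> clique A -> #|A| <= #|K|].
  rewrite /K; case: arg_maxnP => // A /andP[AC clA] Amax; split=> // B BC clB.
  by apply: Amax; rewrite BC.
have [K3|K2] := ltnP 2 #|K|; first exact: (max_clique_colorable Clink KC clK).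
apply: triangle_free_colorable => // x y z xC yC zC xy yz xz.
have := Kmax _ _ (clique3 xy xz yz).
rewrite !subUset !sub1set xC yC zC => /(_ isT) /leq_trans/(_ K2).
by rewrite card_clique3.
Qed.

Lemma connected_linked (r : G) : linked [set x | connect (@adj G) r x].
Proof.
move=> S /subsetP SC /set0Pn[x xS] Scl; apply/subsetP => y; rewrite inE => ry.
have csym : connect_sym (@adj G) := sym_connect_sym (@adj_sym G).
have xr : connect (@adj G) x r by rewrite csym; have := SC x xS; rewrite inE.
have Sclosed : closed (@adj G) (mem S).
  apply: intro_closed => // s t st sS; apply: (Scl s) => //.
  rewrite inE; have := SC s sS; rewrite inE => /connect_trans; apply.
  exact: connect1.
by rewrite -(closed_connect Sclosed (connect_trans xr ry)).
Qed.

End NoP5.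

Theorem theorem5p3 (G : sgraph) (hG : ~ has_vertex_minor G (path_graph 5)) :
  chromatic_number G <= clique_number G + 1.
Proof.
have csym : connect_sym (@adj G) := sym_connect_sym (@adj_sym G).
have col (r : G) : exists f : {ffun G -> 'I_(clique_number G).+1},
    forall x y, connect (@adj G) r x -> adj x y -> f x != f y.
  have [f fw fP] := linked_colorable hG (@connected_linked G r).
  exists [ffun x => Ordinal (fw x : f x < (clique_number G).+1)] => x y rx xy.
  rewrite !ffunE -val_eqE /=; apply: fP => //; rewrite inE //.
  exact: connect_trans rx (connect1 xy).
have [f fP] := fin_all_exists col.
rewrite /chromatic_number; case: ex_minnP => k _; apply; rewrite addn1.
(* Each vertex uses the colouring chosen for the root of its component; adjacent vertices have the
   same root. *)
apply/existsP; exists [ffun x => f (root (@adj G) x) x].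
apply/forallP => x; apply/forallP => y; apply/implyP => xy.
rewrite !ffunE -(rootP csym (connect1 xy)) fP //.
by rewrite csym connect_root.
Qed.
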